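(* Suppose $t(k,h_{\mathcal T})\le\dfrac1{2C_1}$. Then $\eta_{\mathcal T}\eqsim\widetilde\eta_{\mathcal T}$.
   Context: Domain. $\Omega_0,\Omega_1\subset\mathbb R^2$ are open convex polygons with $\overline{\Omega_0}\subset\Omega_1$, both star-shaped with respect to a point of $\Omega_0$; $\Omega:=\Omega_1\setminus\overline{\Omega_0}$, $\Gamma_0:=\partial\Omega_0$, $\Gamma_1:=\partial\Omega_1$, and $n$ is the unit outward normal to $\partial\Omega$. $\omega_{\max}$ is the maximal interior angle of $\Omega$ at the corners on $\Gamma_0$ and $\alpha:=\pi/\omega_{\max}\in(\tfrac12,1)$. The wave number $k$ is large ($k\gg1$, in particular $k\ge1$); $\mathrm i=\sqrt{-1}$. Notation. Functions are complex-valued; $(\cdot,\cdot)$ is the $L^2(\Omega)$ inner product and $\langle\cdot,\cdot\rangle_{\Gamma_1}$ the $L^2(\Gamma_1)$ inner product (conjugate-linear in the second argument); $\|\cdot\|_Q$ is the $L^2(Q)$ norm. Problem. $H^1_{\Gamma_0}(\Omega):=\{v\in H^1(\Omega):v|_{\Gamma_0}=0\}$, $a(u,v):=(\nabla u,\nabla v)-k^2(u,v)-\mathrm ik\langle u,v\rangle_{\Gamma_1}$, $b(u,v):=(\nabla u,\nabla v)+(u,v)$, $f\in L^2(\Omega)$, $g\in H^{1/2}(\Gamma_1)$; $u\in H^1_{\Gamma_0}(\Omega)$ is the unique solution of $a(u,v)=(f,v)+\langle g,v\rangle_{\Gamma_1}$ for all $v\in H^1_{\Gamma_0}(\Omega)$.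 Discretization. $\mathcal T$ is a (shape-)regular conforming triangulation of $\Omega$; $h_T:=|T|^{1/2}$, $h_{\mathcal T}:=\max_{T\in\mathcal T}h_T$; $\mathbb V_{\mathcal T}:=\{v\in H^1_{\Gamma_0}(\Omega):v|_T\in P_1(T)\ \forall T\in\mathcal T\}$. $u_h\in\mathbb V_{\mathcal T}$ is the finite element solution: $a(u_h,v_h)=(f,v_h)+\langle g,v_h\rangle_{\Gamma_1}$ for all $v_h\in\mathbb V_{\mathcal T}$. $\widetilde u_h\in\mathbb V_{\mathcal T}$ is the elliptic projection of $u$: $b(\widetilde u_h,v_h)=b(u,v_h)$ for all $v_h\in\mathbb V_{\mathcal T}$. Estimators. $[\![w]\!]:=w|_T\cdot n_T+w|_{T'}\cdot n_{T'}$ on an interior edge $e=T\cap T'$ ($n_T$ the unit outward normal to $\partial T$). For $v_h\in\mathbb V_{\mathcal T}$: $R_T(v_h):=(f+k^2v_h)|_T$; $R_{\partial T}(v_h)$ on an edge $e\subset\partial T$ equals $-\tfrac12[\![\nabla v_h]\!]$ if $e$ is interior, $-\partial v_h/\partial n+\mathrm ikv_h+g$ if $e\subset\Gamma_1$, and $0$ if $e\subset\Gamma_0$; $\eta_T^2(v_h):=h_T^2\|R_T(v_h)\|_T^2+h_T\|R_{\partial T}(v_h)\|_{\partial T}^2$. Further $\widetilde R_T(v_h):=(f+(k^2+1)u-v_h)|_T$; $\widetilde R_{\partial T}(v_h)$ on $e$ equals $-\tfrac12[\![\nabla v_h]\!]$ if $e$ is interior, $-\partial v_h/\partial n+\mathrm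 iku+g$ if $e\subset\Gamma_1$, $0$ if $e\subset\Gamma_0$; $\widetilde\eta_T^2(v_h):=h_T^2\|\widetilde R_T(v_h)\|_T^2+h_T\|\widetilde R_{\partial T}(v_h)\|_{\partial T}^2$. For $\mathcal M\subset\mathcal T$: $\eta_{\mathcal M}:=(\sum_{T\in\mathcal M}\eta_T^2(u_h))^{1/2}$, $\widetilde\eta_{\mathcal M}:=(\sum_{T\in\mathcal M}\widetilde\eta_T^2(\widetilde u_h))^{1/2}$. $\widetilde{\mathcal M}\subset\mathcal T$ is the set consisting of the elements of $\mathcal M$ and all elements of $\mathcal T$ sharing a common edge with an element of $\mathcal M$. $t(k,h):=k^{1/2}h^{\alpha/2}+k^{3/4+\alpha/2}h^{\alpha}+k^{3/2}h^{(1+\alpha)/2}+k^{3/2+\alpha}h^{2\alpha}+k^3h^{1+\alpha}$. Constants. $C_1,C_2$ with $C_1C_2\ge1$ are constants, independent of $k$, the mesh size, $f,g,u$ (possibly depending on $\Omega$ and shape regularity), such that for every $\mathcal M\subset\mathcal T$: $\eta_{\mathcal M}\le C_1(\widetilde\eta_{\widetilde{\mathcal M}}+t(k,h_{\mathcal T})\eta_{\mathcal T})$ and $\widetilde\eta_{\mathcal M}\le C_2(\eta_{\widetilde{\mathcal M}}+t(k,h_{\mathcal T})\eta_{\mathcal T})$; such constants are known to exist. $A\eqsim B$ means $A\le CB$ and $B\le CA$ with $C>0$ independent of $k$, the mesh size, $f$, $g$ and $u$. *)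

(* Defs.v *)
From HB Require Import structures.
From mathcomp Require Import all_boot all_order all_algebra.
From mathcomp Require Import all_classical all_reals all_analysis.
From mathcomp Require Import complex.

Set Implicit Arguments.
Unset Strict Implicit.
Unset Printing Implicit Defensive.

Import Order.TTheory GRing.Theory Num.Theory.
Import numFieldNormedType.Exports.

Local Open Scope classical_set_scope.
Local Open Scope complex_scope.
Local Open Scope ring_scope.

Notation plane R := (R * R)%type (only parsing).
Notation cfun R := (R * R -> R[i]) (only parsing).

Section Geometry.
Variable R : realType.
Implicit Types (a b c p q : plane R) (e : plane R * plane R) (s : seq (plane R)).

Definition dot p q : R := p.1 * q.1 + p.2 * q.2.

Definition vlen p : R := Num.sqrt (dot p p).

(* Twice the signed area of the triangle a b c; positive iff a, b, c is
   counterclockwise. *)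
Definition orient a b c : R :=
  (b.1 - a.1) * (c.2 - a.2) - (b.2 - a.2) * (c.1 - a.1).

Definition seg_pt e (t : R) : plane R :=
  ((1 - t) * e.1.1 + t * e.2.1, (1 - t) * e.1.2 + t * e.2.2).

Definition seg_set e : set (plane R) := seg_pt e @` [set t : R | 0 <= t <= 1].

Definition seg_len e : R := vlen (e.2 - e.1).

(* The boundary of a polygon with cyclic vertex list s. *)
Definition edges s : seq (plane R * plane R) := zip s (rot 1 s).

Definition edges_set (G : seq (plane R * plane R)) : set (plane R) :=
  [set x | exists2 e, e \in G & seg_set e x].

(* s lists the corners of a convex polygon in counterclockwise order: every
   other corner lies strictly to the left of each directed edge. *)
Definition convex_corners s : Prop :=
  (2 < size s)%N /\
  forall i j : nat, (i < size s)%N -> (j < size s)%N ->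
    j != i -> j != (i.+1 %% size s)%N ->
    0 < orient (nth 0 s i) (nth 0 s (i.+1 %% size s)) (nth 0 s j).

Definition polygon s : set (plane R) :=
  [set x | forall e, e \in edges s -> 0 < orient e.1 e.2 x].

Definition star_shaped (D : set (plane R)) x0 : Prop :=
  forall y, D y -> seg_set (x0, y) `<=` D.

(* Interior angle at the corner b of the convex polygon with consecutive
   corners a, b, c. *)
Definition corner_angle a b c : R :=
  acos (dot (a - b) (c - b) / (vlen (a - b) * vlen (c - b))).

End Geometry.

(* P0 and P1 are the corner lists of the inner and the outer polygon. *)
Section Domain.
Variables (R : realType) (P0 P1 : seq (plane R)).

Definition admissible_domain : Prop :=
  [/\ convex_corners P0, convex_corners P1,
      closure (polygon P0) `<=` polygon P1 &
      exists2 x0, polygon P0 x0 &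
        star_shaped (polygon P0) x0 /\ star_shaped (polygon P1) x0].

Definition Omega : set (plane R) := polygon P1 `\` closure (polygon P0).

Definition Gamma0 := edges P0.
Definition Gamma1 := edges P1.

(* Seen from Omega, the corners of Gamma0 are reentrant. *)
Definition omega_max : R :=
  \big[Num.max/0]_(i < size P0)
    (2 * pi - corner_angle (nth 0 P0 i) (nth 0 (rot 1 P0) i)
                           (nth 0 (rot 2 P0) i)).

Definition alpha : R := pi / omega_max.

Definition t_kh (k h : R) : R :=
  k `^ (1 / 2) * h `^ (alpha / 2) + k `^ (3 / 4 + alpha / 2) * h `^ alpha
  + k `^ (3 / 2) * h `^ ((1 + alpha) / 2)
  + k `^ (3 / 2 + alpha) * h `^ (2 * alpha) + k `^ 3 * h `^ (1 + alpha).

End Domain.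

Section L2.
Variable R : realType.
Implicit Types (F v w : cfun R) (e : plane R * plane R).

Definition leb2 :
    {measure set (measurableTypeR R * measurableTypeR R)%type -> \bar R} :=
  ((@lebesgue_measure R) \x (@lebesgue_measure R))%E.

Definition abs2 (z : R[i]) : R := complex.Re z ^+ 2 + complex.Im z ^+ 2.

Definition cint (d : measure_display) (T : measurableType d)
    (mu : {measure set T -> \bar R}) (D : set T) (F : T -> R[i]) : R[i] :=
  (\int[mu]_(x in D) complex.Re (F x)) +i* (\int[mu]_(x in D) complex.Im (F x)).

Definition isL2 (d : measure_display) (T : measurableType d)
    (mu : {measure set T -> \bar R}) (D : set T) (F : T -> R[i]) : Prop :=
  [/\ measurable_fun D (fun x => complex.Re (F x)),
      measurable_fun D (fun x => complex.Im (F x)) &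
      (\int[mu]_(x in D) (abs2 (F x))%:E < +oo)%E].

Definition ip (D : set (plane R)) v w : R[i] :=
  cint leb2 D (fun x => v x * Num.conj (w x)).

Definition sqnorm (D : set (plane R)) v : R := \int[leb2]_(x in D) abs2 (v x).

Definition unit_itv : set R := `[0, 1]%classic.

Definition isL2_curve (G : seq (plane R * plane R)) w : Prop :=
  forall e, e \in G ->
    isL2 (@lebesgue_measure R) unit_itv (fun t : R => w (seg_pt e t)).

Definition ip_curve (G : seq (plane R * plane R)) v w : R[i] :=
  \sum_(e <- G) (seg_len e)%:C *
    cint (@lebesgue_measure R) unit_itv
      (fun t : R => v (seg_pt e t) * Num.conj (w (seg_pt e t))).

Definition sqnorm_curve (G : seq (plane R * plane R)) w : R :=
  \sum_(e <- G) seg_len e *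
    \int[@lebesgue_measure R]_(t in unit_itv) abs2 (w (seg_pt e t)).

(* H^{1/2}(G), by the Sobolev-Slobodeckij double integral; where the two
   points coincide (a null set) the quotient is 0. *)
Definition isH12_curve (G : seq (plane R * plane R)) g : Prop :=
  isL2_curve G g /\
  (\sum_(e <- G) \sum_(e' <- G) (seg_len e * seg_len e')%:E *
     \int[leb2]_(st in unit_itv `*` unit_itv)
       (abs2 (g (seg_pt e st.1) - g (seg_pt e' st.2))
        / vlen (seg_pt e st.1 - seg_pt e' st.2) ^+ 2)%:E < +oo)%E.

End L2.

Section Sobolev.
Variable R : realType.
Implicit Types (phi : plane R -> R) (v w : cfun R) (D : set (plane R)).

Definition dir (i : bool) : plane R := if i then (0, 1) else (1, 0).

Fixpoint Ck (n : nat) phi : Prop :=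
  continuous phi /\
  if n is n'.+1 then
    forall i, (forall x, derivable phi x (dir i)) /\ Ck n' ('D_(dir i) phi)
  else True.

Definition smooth phi : Prop := forall n, Ck n phi.

Definition test_fun D phi : Prop :=
  let S := closure [set x | phi x != 0] in
  [/\ smooth phi, compact S & S `<=` D].

Definition smoothC v : Prop :=
  smooth (fun x => complex.Re (v x)) /\ smooth (fun x => complex.Im (v x)).

(* Gradients have components indexed by bool, false being the first one. *)
Definition is_wgrad D v (G : bool -> cfun R) : Prop :=
  forall i, isL2 (leb2 R) D (G i) /\
    forall phi, test_fun D phi ->
      cint (leb2 R) D (fun x => v x * ('D_(dir i) phi x)%:C) =
      - cint (leb2 R) D (fun x => G i x * (phi x)%:C).

Definition isH1 D v : Prop :=
  isL2 (leb2 R) D v /\ exists G, is_wgrad D v G.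

Definition wgrad D v : bool -> cfun R :=
  xget (fun _ _ => 0) [set G | is_wgrad D v G].

Definition sqnormH1 D v : R := sqnorm D v + \sum_i sqnorm D (wgrad D v i).

(* The trace on the boundary curve G of D as the continuous extension of the
   restriction map from smooth functions to H^1(D). *)
Definition is_trace D (G : seq (plane R * plane R)) v w : Prop :=
  isL2_curve G w /\
  exists phi : nat -> cfun R,
    [/\ forall n, smoothC (phi n),
        (fun n => sqnormH1 D (fun x => phi n x - v x)) @ \oo --> (0 : R) &
        (fun n => sqnorm_curve G (fun x => phi n x - w x)) @ \oo --> (0 : R)].

Definition trace D G v : cfun R :=
  xget (fun _ => 0) [set w | is_trace D G v w].

End Sobolev.

Record mesh (R : realType) := Mesh {
  mesh_size : nat;
  vtx : 'I_mesh_size -> 'I_3 -> plane R }.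

Section Mesh.
Variable R : realType.

Definition hull (V : 'I_3 -> plane R) (S : {set 'I_3}) : set (plane R) :=
  [set x | exists lam : 'I_3 -> R,
     [/\ forall i, 0 <= lam i, forall i, i \notin S -> lam i = 0,
         \sum_i lam i = 1 &
         x = (\sum_i lam i * (V i).1, \sum_i lam i * (V i).2)]].

Variable m : mesh R.
Implicit Types (T : 'I_(mesh_size m)) (i : 'I_3).

Definition elt T : set (plane R) := hull (vtx T) [set: 'I_3]%SET.

Definition common_vtx T T' : {set 'I_3} :=
  [set i | [exists j, vtx T i == vtx T' j]].

Definition triangulation (D : set (plane R)) : Prop :=
  [/\ forall T, orient (vtx T 0) (vtx T 1) (vtx T 2%:R) != 0,
      \bigcup_T elt T = closure D &
      forall T T', T != T' -> common_vtx T T' != [set: 'I_3]%SET /\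
        elt T `&` elt T' = hull (vtx T) (common_vtx T T')].

(* Every element contains a disc of diameter at least diam(T) / sigma. *)
Definition shape_regular (sigma : R) : Prop :=
  forall T, exists (c : plane R) (r : R),
    [/\ 0 < r, [set x | vlen (x - c) <= r] `<=` elt T &
        forall x y, elt T x -> elt T y -> vlen (x - y) <= sigma * (2 * r)].

Definition hT T : R := Num.sqrt (fine (leb2 R (elt T))).

Definition hmax : R := \big[Num.max/0]_T hT T.

(* The edge of T opposite to its vertex i. *)
Definition edge T i : plane R * plane R := (vtx T (i + 1), vtx T (i + 2%:R)).

Definition bdry T : seq (plane R * plane R) := [seq edge T i | i : 'I_3].

Definition same_edge (e e' : plane R * plane R) : bool :=
  (e == e') || (e == (e'.2, e'.1)).

Definition tilde (M : {set 'I_(mesh_size m)}) : {set 'I_(mesh_size m)} :=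
  [set T | (T \in M) || [exists T' in M, [exists i, [exists j,
             same_edge (edge T i) (edge T' j)]]]].

(* Outward unit normal to T on its edge i: the rotation of the edge by a
   right angle points to the side of vertex i iff the orientation is
   positive. *)
Definition normal T i : plane R :=
  let: (a, b) := edge T i in
  let s := - Num.sg (orient a b (vtx T i)) / vlen (b - a) in
  (s * - (b.2 - a.2), s * (b.1 - a.1)).

(* v is on T the affine function with gradient (c false, c true); sets of
   measure zero, in particular the boundary of T, are disregarded. *)
Definition affine_on T (v : cfun R) (c : bool -> R[i]) : Prop :=
  exists c0, {ae leb2 R, forall x, interior (elt T) x ->
    v x = c0 + c false * (x.1)%:C + c true * (x.2)%:C}.

Definition gradT T (v : cfun R) : bool -> R[i] :=
  xget (fun _ => 0) [set c | affine_on T v c].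

Definition dnT T i (v : cfun R) : R[i] :=
  gradT T v false * ((normal T i).1)%:C + gradT T v true * ((normal T i).2)%:C.

(* The jump of grad v across the interior edge i of T, i.e. the sum of the
   outward normal derivatives over all elements having that edge. *)
Definition jump T i (v : cfun R) : R[i] :=
  \sum_T' \sum_(j | same_edge (edge T i) (edge T' j)) dnT T' j v.

End Mesh.

Section Helmholtz.
Variables (R : realType) (P0 P1 : seq (plane R)) (k : R).
Implicit Types (f g u v w : cfun R).

Let Om := Omega P0 P1.
Let G0 := Gamma0 P0.
Let G1 := Gamma1 P1.

Definition tr v : cfun R := trace Om (G0 ++ G1) v.

Definition H1_Gamma0 v : Prop :=
  isH1 Om v /\
  forall e, e \in G0 ->
    {ae @lebesgue_measure R, forall t : R, unit_itv t -> tr v (seg_pt e t) = 0}.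

Definition ip_grad v w : R[i] := \sum_i ip Om (wgrad Om v i) (wgrad Om w i).

Definition form_a v w : R[i] :=
  ip_grad v w - (k ^+ 2)%:C * ip Om v w - 'i * k%:C * ip_curve G1 (tr v) (tr w).

Definition form_b v w : R[i] := ip_grad v w + ip Om v w.

Definition rhs f g v : R[i] := ip Om f v + ip_curve G1 g (tr v).

Definition weak_solution f g u : Prop :=
  H1_Gamma0 u /\ forall v, H1_Gamma0 v -> form_a u v = rhs f g v.

Variable m : mesh R.

Definition V_T v : Prop :=
  H1_Gamma0 v /\ forall T : 'I_(mesh_size m), exists c, affine_on T v c.

Definition fe_solution f g uh : Prop :=
  V_T uh /\ forall v, V_T v -> form_a uh v = rhs f g v.

Definition elliptic_projection u ut : Prop :=
  V_T ut /\ forall v, V_T v -> form_b ut v = form_b u v.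

Variables f g : cfun R.
Implicit Types (T : 'I_(mesh_size m)) (M : {set 'I_(mesh_size m)}).

Definition RT v : cfun R := fun x => f x + (k ^+ 2)%:C * v x.

Definition RT_tilde u v : cfun R :=
  fun x => f x + (k ^+ 2 + 1)%:C * u x - v x.

(* The residual on the edge i of T; both versions share this formula, with
   w = v for the first and w = u for the second. *)
Definition R_edge w v T i : cfun R :=
  if `[< seg_set (edge T i) `<=` edges_set G0 >] then fun _ => 0
  else if `[< seg_set (edge T i) `<=` edges_set G1 >] then
    fun x => - dnT T i v + 'i * k%:C * tr w x + g x
  else fun _ => - (2%:R^-1) * jump T i v.

Definition RdT v := R_edge v v.
Definition RdT_tilde u v := R_edge u v.

(* Integrals over T are taken over its interior, a subset of Omega. *)
Definition indicator2 (r : cfun R) (re : forall T, 'I_3 -> cfun R) T : R :=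
  hT T ^+ 2 * sqnorm (interior (elt T)) r
  + hT T * \sum_i sqnorm_curve [:: edge T i] (re T i).

Definition eta2 v T : R := indicator2 (RT v) (RdT v) T.

Definition eta2_tilde u v T : R :=
  indicator2 (RT_tilde u v) (RdT_tilde u v) T.

Definition eta uh M : R := Num.sqrt (\sum_(T in M) eta2 uh T).

Definition eta_tilde u ut M : R := Num.sqrt (\sum_(T in M) eta2_tilde u ut T).

End Helmholtz.

(* The standing setting: u, uh and ut are the exact solution, the finite
   element solution and the elliptic projection for wave number k, mesh m and
   data f, g. *)
Definition setting (R : realType) (P0 P1 : seq (plane R)) (sigma k0 k : R)
    (m : mesh R) (f g u uh ut : cfun R) : Prop :=
  [/\ k0 <= k, triangulation m (Omega P0 P1) /\ shape_regular m sigma,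
      isL2 (leb2 R) (Omega P0 P1) f /\ isH12_curve (Gamma1 P1) g,
      weak_solution P0 P1 k f g u &
      fe_solution P0 P1 k m f g uh /\ elliptic_projection P0 P1 m u ut].

(* Main.v *)
Require Import Defs.
From mathcomp Require Import all_boot all_order all_algebra.
From mathcomp Require Import all_classical all_reals all_analysis.
From mathcomp Require Import complex.
From mathcomp Require Import ring lra.
Import Order.TTheory GRing.Theory Num.Theory.
Local Open Scope ring_scope.

(** The whole mesh is its own edge neighbourhood, so the two localized bounds,
    taken on all of the mesh, compare the same two global quantities eta and
    eta_tilde.  In the first bound the perturbation C1 * t * eta is at most
    eta / 2 by the smallness of t, hence can be absorbed on the left, giving
    eta <= 2 C1 * eta_tilde.  In the second one the perturbation is a
    multiple of eta with a factor at most 1 / (2 C1), giving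
    eta_tilde <= C2 (1 + 1 / (2 C1)) * eta.

    The sign of C1 comes from t, a sum of products of real powers: since
    t >= 0, the condition t <= 1 / (2 C1) can hold only if C1 >= 0, and
    C1 * C2 >= 1 then makes both constants positive. *)

Lemma t_kh_ge0 {R : realType} (P : seq (plane R)) (k h : R) :
  0 <= t_kh P k h.
Proof. by rewrite /t_kh !addr_ge0// mulr_ge0// powR_ge0. Qed.

Lemma tilde_setT (R : realType) (m : mesh R) :
  tilde [set: 'I_(mesh_size m)] = [set: 'I_(mesh_size m)].
Proof. by apply/finset.setP => T; rewrite !inE. Qed.

(** Absorption: t <= 1 / (2 C1) leaves at least half of x on the left of the
    first bound. *)
Lemma perturbed_bounds_equivalence {R : realFieldType} {C1 C2 t x y : R} :
  0 < C1 -> 0 < C2 -> 0 <= x -> t <= 1 / (2 * C1) ->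
  x <= C1 * (y + t * x) -> y <= C2 * (x + t * x) ->
  x <= 2 * C1 * y /\ y <= C2 * (1 + 1 / (2 * C1)) * x.
Proof.
move=> C1_gt0 C2_gt0 x_ge0 t_le x_le y_le.
have tx_le : t * x <= 1 / (2 * C1) * x by exact: ler_wpM2r.
have C1tx_le : C1 * (t * x) <= x / 2.
  have -> : x / 2 = C1 * (1 / (2 * C1) * x) by field; rewrite gt_eqF.
  by rewrite ler_pM2l.
split; first by lra.
apply: (le_trans y_le); rewrite -mulrA ler_pM2l//; lra.
Qed.

Theorem corollary3p6 (R : realType) (P0 P1 : seq (plane R))
    (hdom : admissible_domain P0 P1)
    (sigma k0 C1 C2 : R) (hk0 : 1 <= k0) (hC : 1 <= C1 * C2)
    (hbounds : forall (k : R) (m : mesh R) (f g u uh ut : cfun R),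
      setting P0 P1 sigma k0 k m f g u uh ut ->
      forall M : {set 'I_(mesh_size m)},
        eta P0 P1 k f g uh M <=
          C1 * (eta_tilde P0 P1 k f g u ut (tilde M)
                + t_kh P0 k (hmax m) * eta P0 P1 k f g uh [set: 'I_(mesh_size m)])
        /\
        eta_tilde P0 P1 k f g u ut M <=
          C2 * (eta P0 P1 k f g uh (tilde M)
                + t_kh P0 k (hmax m) * eta P0 P1 k f g uh [set: 'I_(mesh_size m)])) :
  exists C : R, 0 < C /\
    forall (k : R) (m : mesh R) (f g u uh ut : cfun R),
      setting P0 P1 sigma k0 k m f g u uh ut ->
      t_kh P0 k (hmax m) <= 1 / (2 * C1) ->
      eta P0 P1 k f g uh [set: 'I_(mesh_size m)] <= C * eta_tilde P0 P1 k f g u ut [set: 'I_(mesh_size m)]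
      /\
      eta_tilde P0 P1 k f g u ut [set: 'I_(mesh_size m)] <= C * eta P0 P1 k f g uh [set: 'I_(mesh_size m)].
Proof.
have [C1_le0 | C1_gt0] := leP C1 0.
  (* Here 1 / (2 * C1) < 0 <= t, as C1 = 0 contradicts C1 * C2 >= 1. *)
  exists 1; split=> // k m f g u uh ut _ t_le.
  have C1_lt0 : C1 < 0.
    rewrite lt_neqAle C1_le0 andbT; apply/eqP => C1_0.
    by move: hC; rewrite C1_0 mul0r ler10.
  have := le_trans (t_kh_ge0 P0 k (hmax m)) t_le.
  by rewrite div1r invr_ge0 pmulr_rge0// leNgt C1_lt0.
have C2_gt0 : 0 < C2 by rewrite -(pmulr_rgt0 _ C1_gt0) (lt_le_trans ltr01).
have C2'_gt0 : 0 < C2 * (1 + 1 / (2 * C1)).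
  by rewrite mulr_gt0// addr_gt0// divr_gt0// mulr_gt0.
exists (2 * C1 + C2 * (1 + 1 / (2 * C1))).
split=> [|k m f g u uh ut hs t_le]; first by rewrite addr_gt0// mulr_gt0.
have [] := hbounds k m f g u uh ut hs [set: 'I_(mesh_size m)].
rewrite tilde_setT => eta_le etat_le.
have eta_ge0 : 0 <= eta P0 P1 k f g uh [set: 'I_(mesh_size m)].
  exact: sqrtr_ge0.
have etat_ge0 : 0 <= eta_tilde P0 P1 k f g u ut [set: 'I_(mesh_size m)].
  exact: sqrtr_ge0.
have [eta_le' etat_le'] := perturbed_bounds_equivalence
  C1_gt0 C2_gt0 eta_ge0 t_le eta_le etat_le.
split.
  by apply: (le_trans eta_le'); apply: (ler_wpM2r etat_ge0); rewrite lerDl ltW.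
apply: (le_trans etat_le'); apply: (ler_wpM2r eta_ge0).
by rewrite lerDr mulr_ge0// ltW.
Qed.
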